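(* Let $p\ge 3$ and $n\ge 0$ be integers, and let $A_n^p(\mathbf{x};\mathbf{y})$, $B_n^p(\mathbf{x};\mathbf{y})$ be the terminating multiple hypergeometric series defined in the context, for $\mathbf{x}=(x_1,\dots,x_{p-1})$, $\mathbf{y}=(y_1,\dots,y_p)$. Then: (i) $A_n^p(\mathbf{x};\mathbf{y})=B_n^p(\mathbf{x};\mathbf{y})$; denote the common value by $g_n^p(\mathbf{x};\mathbf{y})$. (ii) $g_n^p(\mathbf{x};\mathbf{y})$ is symmetric with respect to permutations of the components of $\mathbf{x}$ and symmetric with respect to permutations of the components of $\mathbf{y}$. (iii) For every integer $m\ge 0$ and arbitrary $\omega\in\{1,\dots,p-1\}$, $$g_{m+1}^{p}(\mathbf{x};\mathbf{y})=g_{m+1}^{p}\big((\mathbf{x}_{[\omega]},\,\nu(\mathbf{x};\mathbf{y})+m);\mathbf{y}\big),$$ where $\mathbf{x}_{[\omega]}$ is $\mathbf{x}$ with the component $x_\omega$ removed and $\nu(\mathbf{x};\mathbf{y})=\sum_{j=1}^{p}y_j-\sum_{j=1}^{p-1}x_j$. (iv) $g_n^p(\mathbf{x};\mathbf{y})$ is non-negative if $\nu_m\ge 0$ and $y_{m+1}\ge x_m$ for $m=1,\dots,p-1$ or, equivalently, if $\nu_m\ge 0$ and $\nu_m-y_m+y_{m+1}\ge 0$ for $m=1,\dots,p-1$, where $\nu_m=\sum_{k=1}^m(y_k-x_k)$.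
   Context: $(c)_k=c(c+1)\cdots(c+k-1)$, $(c)_0=1$, is the Pochhammer symbol. The vectors $\mathbf{x}\in\mathbb{C}^{p-1}$, $\mathbf{y}\in\mathbb{C}^p$ are complex (real where inequalities are imposed). Set $\nu_m=\sum_{k=1}^{m}(y_k-x_k)$ for $1\le m\le p-1$, and $\psi_m=\sum_{j=1}^m y_j-\sum_{j=1}^{m-1}x_j$ for $1\le m\le p$. For $\mathbf{l}_{p-2}=(l_1,\dots,l_{p-2})\in\mathbb{N}_0^{p-2}$ put $l_0=0$, $l_{p-1}=n-l_1-\cdots-l_{p-2}$, $|\mathbf{l}_0|=0$ and $|\mathbf{l}_s|=l_1+\cdots+l_s$ (so $|\mathbf{l}_{p-1}|=n$). The sums terminate because of the factor $(-n)_{|\mathbf{l}_{p-2}|}$. First series: $$A_n^p(\mathbf{x};\mathbf{y})=\frac{(\nu_{p-1})_{n}(y_{p}-x_{p-1})_{n}}{n!}\sum_{\mathbf{l}_{p-2}\in\mathbb{N}_0^{p-2}}\frac{(-n)_{|\mathbf{l}_{p-2}|}}{(1-y_{p}+x_{p-1}-n)_{|\mathbf{l}_{p-2}|}}\prod_{s=1}^{p-2}\frac{(\nu_{s})_{|\mathbf{l}_{s}|}(y_{s+1}-x_s)_{l_{s}}}{(\nu_{s+1})_{|\mathbf{l}_{s}|}\,l_s!}.$$ Second series, for odd $p\ge3$: $$B_n^p(\mathbf{x};\mathbf{y})=\sum_{\mathbf{l}_{p-2}\in\mathbb{N}_0^{p-2}}\frac{(-n)_{|\mathbf{l}_{p-2}|}(-1)^{l_2+l_4+\cdots+l_{p-3}}}{l_{1}!\cdots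 l_{p-2}!\,n!}\prod_{\substack{2\le m\le p-1\\ m\text{ even}}}\frac{(\psi_{m-1}-x_{m-1})_{|\mathbf{l}_{m-1}|}(\psi_{m-1}-x_{m})_{|\mathbf{l}_{m-1}|}(\psi_{m+1}-y_{m})_{|\mathbf{l}_{m}|}(\psi_{m+1}-y_{m+1})_{|\mathbf{l}_{m}|}}{(\psi_{m-1}-x_{m-1})_{|\mathbf{l}_{m-2}|}(\psi_{m-1}-x_{m})_{|\mathbf{l}_{m-2}|}(\psi_{m+1}-y_{m})_{|\mathbf{l}_{m-1}|}(\psi_{m+1}-y_{m+1})_{|\mathbf{l}_{m-1}|}}$$ (the sign exponent is $0$ for $p=3$), and for even $p\ge4$: $$B_n^p(\mathbf{x};\mathbf{y})=\sum_{\mathbf{l}_{p-2}\in\mathbb{N}_0^{p-2}}\frac{(-n)_{|\mathbf{l}_{p-2}|}(-1)^{l_1+l_3+\cdots+l_{p-3}}}{l_{1}!\cdots l_{p-2}!\,n!}(\psi_2-y_2)_{l_1}(\psi_2-y_1)_{l_1}\prod_{\substack{2\le m\le p-2\\ m\text{ even}}}\frac{(\psi_{m}-x_{m})_{|\mathbf{l}_{m}|}(\psi_{m}-x_{m+1})_{|\mathbf{l}_{m}|}(\psi_{m+2}-y_{m+1})_{|\mathbf{l}_{m+1}|}(\psi_{m+2}-y_{m+2})_{|\mathbf{l}_{m+1}|}}{(\psi_{m}-x_{m})_{|\mathbf{l}_{m-1}|}(\psi_{m}-x_{m+1})_{|\mathbf{l}_{m-1}|}(\psi_{m+2}-y_{m+1})_{|\mathbf{l}_{m}|}(\psi_{m+2}-y_{m+2})_{|\mathbf{l}_{m}|}}.$$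 Both expressions represent polynomials in $(\mathbf{x},\mathbf{y})$ (after cancellation of Pochhammer symbols).
   Formalization: In (iv) the second condition is corrected to ν_m≥0 and ν_m−ν_{m−1}−y_m+y_{m+1}≥0 (ν_0=0); the printed one is only implied by the first and fails: p=3, n=1, x=(0,0), y=(1,0,−1) meets it but g_1=−1. *)

(* Defs.v *)
From HB Require Import structures.
From mathcomp Require Import all_boot all_order all_fingroup all_algebra fraction.
From mathcomp Require Import reals complex mpoly.

Set Implicit Arguments.
Unset Strict Implicit.
Unset Printing Implicit Defensive.

Import Order.TTheory GRing.Theory Num.Theory.
Local Open Scope ring_scope.

Definition poch (F : pzSemiRingType) (c : F) (k : nat) : F :=
  \prod_(i < k) (c + i%:R).

(* 1-based component v_k of a row vector; the value outside 1 <= k <= m is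
   irrelevant, since such indices never occur below. *)
Definition vcomp (F : nmodType) (m : nat) (v : 'rV[F]_m) (k : nat) : F :=
  if insub k.-1 is Some i then v 0 i else 0.

Section Series.
Variables (F : fieldType) (p n : nat).
Variables (x : 'rV[F]_p.-1) (y : 'rV[F]_p).

Definition nu_ (m : nat) : F :=
  \sum_(1 <= k < m.+1) (vcomp y k - vcomp x k).

Definition psi_ (m : nat) : F :=
  \sum_(1 <= j < m.+1) vcomp y j - \sum_(1 <= j < m) vcomp x j.

Definition nu_total : F := \sum_(j < p) y 0 j - \sum_(j < p.-1) x 0 j.

(* The multi-index (l_1, ..., l_{p-2}) is 0-based here: l_s is l (s - 1).
   Restricting each l_s to 0..n loses nothing, because the factor
   (-n)_{|l_{p-2}|} vanishes as soon as l_1 + ... + l_{p-2} > n. *)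
Definition mindex := {ffun 'I_p.-2 -> 'I_n.+1}.

Definition lc (l : mindex) (s : nat) : nat :=
  if insub s.-1 is Some i then l i else 0%N.

(* |l_s|; the completion l_{p-1} = n - l_1 - ... - l_{p-2} makes |l_{p-1}| = n *)
Definition lsum (l : mindex) (s : nat) : nat :=
  if (s < p.-1)%N then (\sum_(1 <= i < s.+1) lc l i)%N else n.

Definition seriesA : F :=
  poch (nu_ p.-1) n * poch (vcomp y p - vcomp x p.-1) n / n`!%:R *
  \sum_(l : mindex)
    (poch (- n%:R) (lsum l p.-2)
       / poch (1 - vcomp y p + vcomp x p.-1 - n%:R) (lsum l p.-2) *
     \prod_(1 <= s < p.-1)
       ((poch (nu_ s) (lsum l s) * poch (vcomp y s.+1 - vcomp x s) (lc l s))
          / (poch (nu_ s.+1) (lsum l s) * (lc l s)`!%:R))).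

Definition seriesB_odd : F :=
  \sum_(l : mindex)
    (poch (- n%:R) (lsum l p.-2)
       * (-1) ^+ (\sum_(1 <= i < p.-2 | ~~ odd i) lc l i)%N
       / ((\prod_(1 <= i < p.-1) (lc l i)`!%:R) * n`!%:R) *
     \prod_(2 <= m < p | ~~ odd m)
       ((poch (psi_ m.-1 - vcomp x m.-1) (lsum l m.-1)
         * poch (psi_ m.-1 - vcomp x m) (lsum l m.-1)
         * poch (psi_ m.+1 - vcomp y m) (lsum l m)
         * poch (psi_ m.+1 - vcomp y m.+1) (lsum l m))
        / (poch (psi_ m.-1 - vcomp x m.-1) (lsum l m.-2)
           * poch (psi_ m.-1 - vcomp x m) (lsum l m.-2)
           * poch (psi_ m.+1 - vcomp y m) (lsum l m.-1)
           * poch (psi_ m.+1 - vcomp y m.+1) (lsum l m.-1)))).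

Definition seriesB_even : F :=
  \sum_(l : mindex)
    (poch (- n%:R) (lsum l p.-2)
       * (-1) ^+ (\sum_(1 <= i < p.-2 | odd i) lc l i)%N
       / ((\prod_(1 <= i < p.-1) (lc l i)`!%:R) * n`!%:R) *
     (poch (psi_ 2 - vcomp y 2) (lc l 1) * poch (psi_ 2 - vcomp y 1) (lc l 1)) *
     \prod_(2 <= m < p.-1 | ~~ odd m)
       ((poch (psi_ m - vcomp x m) (lsum l m)
         * poch (psi_ m - vcomp x m.+1) (lsum l m)
         * poch (psi_ m.+2 - vcomp y m.+1) (lsum l m.+1)
         * poch (psi_ m.+2 - vcomp y m.+2) (lsum l m.+1))
        / (poch (psi_ m - vcomp x m) (lsum l m.-1)
           * poch (psi_ m - vcomp x m.+1) (lsum l m.-1)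
           * poch (psi_ m.+2 - vcomp y m.+1) (lsum l m)
           * poch (psi_ m.+2 - vcomp y m.+2) (lsum l m)))).

Definition seriesB : F := if odd p then seriesB_odd else seriesB_even.

End Series.

(* (x_[w], c): remove the component with (0-based) index w and append c *)
Definition drop_append (F : nmodType) (m : nat) (x : 'rV[F]_m) (w : 'I_m)
    (c : F) : 'rV[F]_m :=
  \row_(j < m) if j.+1 == m then c else vcomp x (bump w j).+1.

(* The series are rational functions of (x, y) whose denominators vanish at
   some points, so they are evaluated at vectors of indeterminates, in the
   fraction field of C[x_1, ..., x_{p-1}, y_1, ..., y_p]. *)
Section Generic.
Variables (C : fieldType) (p : nat).

Definition genx : 'rV[{fraction {mpoly C[p.-1 + p]}}]_p.-1 :=
  \row_(i < p.-1) FracField.tofrac ('X_(lshift p i) : {mpoly C[p.-1 + p]}).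

Definition geny : 'rV[{fraction {mpoly C[p.-1 + p]}}]_p :=
  \row_(j < p) FracField.tofrac ('X_(rshift p.-1 j) : {mpoly C[p.-1 + p]}).

Definition evalxy (g : {mpoly C[p.-1 + p]}) (x : 'rV[C]_p.-1) (y : 'rV[C]_p) : C :=
  g.@[row_mx x y 0].

End Generic.

Definition to_complex (R : realType) (m : nat) (v : 'rV[R]_m) : 'rV[R[i]]_m :=
  map_mx (real_complex R) v.

Section Nonnegativity.
Variables (R : realType) (p : nat) (x : 'rV[R]_p.-1) (y : 'rV[R]_p).

Definition nonneg_cond : Prop :=
  forall m : nat, (1 <= m <= p.-1)%N ->
    0 <= nu_ x y m /\ vcomp x m <= vcomp y m.+1.

Definition nonneg_cond_nu : Prop :=
  forall m : nat, (1 <= m <= p.-1)%N ->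
    0 <= nu_ x y m /\ 0 <= nu_ x y m - vcomp y m + vcomp y m.+1.

(* nonneg_cond_nu is strictly weaker than nonneg_cond, and does not imply
   non-negativity of the polynomial: for p = 3, n = 1, x = (0, 0) and
   y = (1, 0, -1) it holds, but the value is
   nu_2 (y_3 - x_2) + nu_1 (y_2 - x_1) = -1.  An equivalent form of
   nonneg_cond is obtained from it by subtracting nu_{m-1} (with nu_0 = 0). *)
Definition nonneg_cond_dnu : Prop :=
  forall m : nat, (1 <= m <= p.-1)%N ->
    0 <= nu_ x y m
    /\ 0 <= nu_ x y m - nu_ x y m.-1 - vcomp y m + vcomp y m.+1.

End Nonnegativity.

(* Main.v *)
(* In terms of the partial sums k_s = |l_s|, with k_0 = 0 and k_{p-1} = n, each
   series is a sum over chains k_0 <= ... <= k_{p-1} of a product of one-step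
   kernels in (k_{s-1}, k_s).  For A the s-th kernel is, with l = k_s - k_{s-1},
   (y_{s+1} - x_s)_l (nu_s + k_{s-1})_l / l!, so A is a polynomial and (iv) is
   clear.  The composite of two consecutive kernels of A equals that of two
   consecutive kernels of B: this is the case p = 3 with y_1 replaced by
   nu_{s-1} + y_s + k_{s-1}, a double application of Vandermonde's formula.
   Hence A = B.  The two-step composite is visibly symmetric in x_s, x_{s+1} and
   in y_{s+1}, y_{s+2} when written in the form B, and the first kernel of A is
   symmetric in y_1, y_2; this gives (ii).  By (ii) it is enough to prove (iii)
   for the last component of x, where the substitution exchanges the two
   Pochhammer symbols of the last kernel of A. *)
Require Import Defs.
From HB Require Import structures.
From mathcomp Require Import all_boot all_order all_fingroup all_algebra fraction.
From mathcomp Require Import reals complex mpoly.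
From mathcomp Require Import ring zify.

Set Implicit Arguments.
Unset Strict Implicit.
Unset Printing Implicit Defensive.

Import Order.TTheory GRing.Theory Num.Theory.
Local Open Scope ring_scope.

(** * Pochhammer symbols and Vandermonde sums *)

Lemma poch0 (F : pzSemiRingType) (c : F) : poch c 0 = 1.
Proof. by rewrite /poch big_ord0. Qed.

Lemma pochS (F : pzSemiRingType) (c : F) k :
  poch c k.+1 = poch c k * (c + k%:R).
Proof. by rewrite /poch big_ord_recr. Qed.

Lemma pochD (F : pzSemiRingType) (c : F) i j :
  poch c (i + j) = poch c i * poch (c + i%:R) j.
Proof.
elim: j => [|j IHj]; first by rewrite addn0 poch0 mulr1.
by rewrite addnS !pochS IHj mulrA natrD addrA.
Qed.

(** Stated without division, so as to hold in any commutative ring. For [k > n] the symbol contains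
    the factor [- n + n]. *)
Lemma poch_opp_nat (F : comPzRingType) n k :
  poch (- n%:R) k * (n - k)`!%:R =
  (if (k <= n)%N then (-1) ^+ k * n`!%:R else 0) :> F.
Proof.
elim: k => [|k IHk]; first by rewrite poch0 subn0 expr0.
rewrite pochS; case: ltnP => [lt_kn|le_nk].
  move: IHk; rewrite (ltnW lt_kn) -(subnSK lt_kn) factS natrM (subnSK lt_kn).
  rewrite natrB ?(ltnW lt_kn) // exprS -mulrA mulN1r => IHk.
  by rewrite mulNr -IHk; ring.
case: (ltngtP k n) le_nk => // [lt_nk|->] _; last by rewrite addNr mulr0 mul0r.
suff -> : poch (- n%:R : F) k = 0 by rewrite !mul0r.
by rewrite -(subnKC lt_nk) pochD pochS addNr mulr0 mul0r.
Qed.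

(** Taken in reverse order, the factors of [poch d n] are the [-(c + i)]. *)
Lemma poch_reflect (F : comPzRingType) (c d : F) n :
  c + d = 1 - n%:R -> poch d n = (-1) ^+ n * poch c n.
Proof.
move=> cd; rewrite /poch (reindex_inj rev_ord_inj) /=.
have -> : (-1) ^+ n = \prod_(i < n) -1 :> F by rewrite prodr_const card_ord.
rewrite -big_split /=.
apply: eq_bigr => i _; rewrite natrB //.
have -> : d = 1 - n%:R - c by rewrite -cd addrC addKr.
by rewrite -natr1; ring.
Qed.

Lemma poch_vandermonde (F : comPzRingType) (a b : F) n :
  poch (a + b) n = \sum_(k < n.+1) 'C(n, k)%:R * poch a k * poch b (n - k).
Proof.
elim: n => [|n IHn]; first by rewrite big_ord1 !poch0 !mulr1.
(* The new factor is split as [(a + k) + (b + (n - k))]; Pascal's rule then recombines the two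
   sums. *)
have -> : poch (a + b) n.+1 =
    \sum_(k < n.+1) 'C(n, k)%:R * poch a k.+1 * poch b (n - k) +
    \sum_(k < n.+1) 'C(n, k)%:R * poch a k * poch b (n.+1 - k).
  rewrite pochS IHn mulr_suml -big_split; apply: eq_bigr => k _ /=.
  have le_kn : (k <= n)%N by rewrite -ltnS.
  by rewrite subSn // !pochS natrB //; ring.
rewrite [RHS]big_ord_recl [X in _ + X = _]big_ord_recl /= !bin0 !poch0 !subn0.
rewrite addrCA; congr (_ + _).
rewrite [in RHS](eq_bigr (fun k : 'I_n.+1 =>
    'C(n, k)%:R * poch a k.+1 * poch b (n - k) +
    'C(n, k.+1)%:R * poch a k.+1 * poch b (n - k))); last first.
  by move=> k _; rewrite /bump /= add1n subSS binS natrD; ring.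
rewrite [RHS]big_split /=; congr (_ + _).
by rewrite [RHS]big_ord_recr /= bin_small // !mul0r addr0.
Qed.

(** Vandermonde for the reflected symbol: [e - v] reflects to [v + (1 - e - k)], and reflecting the
    second factor back leaves the sign [(-1) ^+ l]. *)
Lemma poch_vandermonde_sub (F : comPzRingType) (e v : F) k :
  poch (e - v) k =
  \sum_(l < k.+1) 'C(k, l)%:R * (-1) ^+ l * poch v l * poch (e + l%:R) (k - l).
Proof.
rewrite (@poch_reflect _ (v + (1 - e - k%:R))); last by ring.
rewrite poch_vandermonde mulr_sumr; apply: eq_bigr => l _.
have le_lk : (l <= k)%N by rewrite -ltnS.
rewrite (@poch_reflect _ (e + l%:R) _ (k - l)); last by rewrite natrB //; ring.
rewrite -{1}(subnK le_lk) exprD; have := sqrr_sign F (k - l).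
rewrite expr2; set s := (-1) ^+ (k - l) => ss.
transitivity (s * s * ('C(k, l)%:R * (-1) ^+ l * poch v l * poch (e + l%:R) (k - l))).
  by ring.
by rewrite ss mul1r.
Qed.

Lemma sum_ord_shift (V : nmodType) (N i j : nat) (f : nat -> V) :
  (i <= j <= N)%N -> (forall k, ~~ (i <= k <= j)%N -> f k = 0) ->
  \sum_(k < N.+1) f k = \sum_(l < (j - i).+1) f (i + l)%N.
Proof.
move=> /andP[le_ij le_jN] f0.
rewrite -(big_mkord xpredT) (@big_cat_nat _ _ _ i) ?(leq_trans le_ij) //=; last exact: leqW.
rewrite big_nat_cond big1 ?add0r => [|k /andP[/andP[_ lt_ki] _]]; last first.
  by apply: f0; rewrite leqNgt lt_ki.
rewrite (@big_cat_nat _ _ _ j.+1) /=; [|exact: leqW|by rewrite ltnS].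
rewrite [X in _ + X]big_nat_cond [X in _ + X]big1 ?addr0; last first.
  by move=> k /andP[/andP[lt_jk _] _]; apply: f0; rewrite [(k <= j)%N]leqNgt lt_jk andbF.
rewrite -[in LHS](add0n i) big_addn subSn // big_mkord.
by apply: eq_bigr => l _; rewrite addnC.
Qed.

(** Put [k = l + j]. The product of binomials becomes ['C(N, l) * 'C(N - l, j)], and a Vandermonde
    sum with parameters [u + l] and [c] remains. *)
Lemma sum_binM_poch (F : comPzRingType) (u c : F) N l : (l <= N)%N ->
  \sum_(k < N.+1) ('C(N, k) * 'C(k, l))%:R * poch u k * poch c (N - k) =
  'C(N, l)%:R * poch u l * poch (c + u + l%:R) (N - l).
Proof.
move=> le_lN; pose f k := ('C(N, k) * 'C(k, l))%:R * poch u k * poch c (N - k) : F.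
rewrite (@sum_ord_shift _ _ l N f) ?le_lN ?leqnn // => [|k]; last first.
  rewrite negb_and -!ltnNge /f => /orP[lt_kl|lt_Nk].
    by rewrite (@bin_small k) // muln0 !mul0r.
  by rewrite (@bin_small N) // mul0n !mul0r.
rewrite -addrA [c + _]addrC poch_vandermonde mulr_sumr.
apply: eq_bigr => j _; rewrite /f subnDA.
have le_j : (l + j <= N)%N by rewrite -leq_subRL // -ltnS.
suff -> : ('C(N, l + j) * 'C(l + j, l) = 'C(N, l) * 'C(N - l, j))%N.
  by rewrite pochD natrM; ring.
have fpos := fact_gt0; apply/eqP.
rewrite -(@eqn_pmul2r (l`! * (j`! * (N - l - j)`!))) ?muln_gt0 ?fpos //.
have e1 := bin_fact le_lN.
have e2 : ('C(N - l, j) * (j`! * (N - l - j)`!) = (N - l)`!)%N by apply: bin_fact; lia.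
have e3 := bin_fact le_j; have e4 := bin_fact (leq_addr j l).
rewrite addKn in e4; rewrite subnDA in e3.
apply/eqP; transitivity N`!.
  by rewrite -e3 -e4; ring.
by rewrite -e1 -e2; ring.
Qed.

(* Expand [(e - v)_k] by Vandermonde, exchange the sums, and sum over [k] by
   Vandermonde again. *)
Lemma poch_sheppard (F : comPzRingType) (u v e c : F) N :
  \sum_(k < N.+1) 'C(N, k)%:R *
    (poch (e - v) k * poch u k * (poch c (N - k) * poch (e + k%:R) (N - k))) =
  \sum_(l < N.+1) 'C(N, l)%:R * (-1) ^+ l *
    (poch u l * poch v l * (poch (e + l%:R) (N - l) * poch (c + u + l%:R) (N - l))).
Proof.
transitivity (\sum_(k < N.+1) \sum_(l < N.+1)
    (-1) ^+ l * poch v l * poch (e + l%:R) (N - l) *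
    (('C(N, k) * 'C(k, l))%:R * poch u k * poch c (N - k))).
  apply: eq_bigr => k _; have le_kN : (k <= N)%N by rewrite -ltnS.
  pose f l := (-1) ^+ l * poch v l * poch (e + l%:R) (N - l) *
    (('C(N, k) * 'C(k, l))%:R * poch u k * poch c (N - k)).
  rewrite (@sum_ord_shift _ _ 0 k f) ?le_kN // => [|l]; last first.
    by rewrite /= -ltnNge /f => lt_kl; rewrite (@bin_small k) // muln0 !mul0r mulr0.
  rewrite subn0 poch_vandermonde_sub !(mulr_suml, mulr_sumr); apply: eq_bigr => l _.
  have le_lk : (l <= k)%N by rewrite -ltnS.
  (* [(e + l)_{k-l}] and [(e + k)_{N-k}] merge into [(e + l)_{N-l}], which is free of [k]. *)
  rewrite /f add0n natrM (_ : (N - l)%N = (k - l + (N - k))%N) ?pochD; last by lia.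
  by rewrite -addrA -natrD subnKC //; ring.
rewrite exchange_big; apply: eq_bigr => l _ /=.
have le_lN : (l <= N)%N by rewrite -ltnS.
by rewrite -mulr_sumr sum_binM_poch //; ring.
Qed.

(** * One-step kernels and their two-step composites *)

Definition kern (F : comUnitRingType) (a b : F) (i j : nat) : F :=
  if (i <= j)%N then poch a (j - i) * poch b (j - i) / (j - i)`!%:R else 0.

Lemma kernC (F : comUnitRingType) (a b : F) i j : kern a b i j = kern b a i j.
Proof. by rewrite /kern [poch a _ * _]mulrC. Qed.

Lemma kern_gt (F : comUnitRingType) (a b : F) i j : (j < i)%N -> kern a b i j = 0.
Proof. by rewrite /kern ltnNge => /negbTE ->. Qed.

(** Only factorials are inverted, and they are assumed to be units rather than nonzero elements of a
    field, so that kernels can be used over the polynomial ring too. *)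
Lemma divf_factM (F : comUnitRingType) (a b : F) l m :
  (forall k, (k`!%:R : F) \is a GRing.unit) -> (l <= m)%N ->
  a / l`!%:R * (b / (m - l)`!%:R) * m`!%:R = 'C(m, l)%:R * (a * b).
Proof.
move=> Fu le_lm; rewrite -(bin_fact le_lm) !natrM.
have := mulVr (Fu l); have := mulVr (Fu (m - l)%N).
set q := _^-1 => q1; set r := _^-1 => r1.
transitivity (q * (m - l)`!%:R * (r * l`!%:R) * ('C(m, l)%:R * (a * b))); first by ring.
by rewrite q1 r1 !mul1r.
Qed.

(** Multiplied by [(j - i)!], this is [poch_sheppard] of order [j - i] with [u = a - x + i],
    [v = a - x' + i], [e = a + b - x - x' + i], and [c - x'] for [c]. *)
Lemma kern_two_step (F : comUnitRingType) (a b c x x' : F) (N i j : nat) :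
  (forall k, (k`!%:R : F) \is a GRing.unit) -> (j <= N)%N ->
  \sum_(k < N.+1) kern (b - x) (a - x + i%:R) i k *
                  kern (c - x') (a + b - x - x' + k%:R) k j =
  \sum_(k < N.+1) (-1) ^+ (k - i) * kern (a - x + i%:R) (a - x' + i%:R) i k *
                  kern (a + b - x - x' + k%:R) (a + c - x - x' + k%:R) k j.
Proof.
move=> Fu le_jN; have [le_ij|lt_ji] := leqP i j; last first.
  rewrite !big1 // => k _; have [le_ik|lt_ki] := leqP i k.
  - by rewrite (@kern_gt _ _ _ k j) ?mulr0 // (leq_trans lt_ji).
  - by rewrite kern_gt // mulr0 mul0r.
  - by rewrite (@kern_gt _ _ _ k j) ?mulr0 // (leq_trans lt_ji).
  - by rewrite kern_gt // mul0r.
pose f k := kern (b - x) (a - x + i%:R) i k * kern (c - x') (a + b - x - x' + k%:R) k j.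
pose g k := (-1) ^+ (k - i) * kern (a - x + i%:R) (a - x' + i%:R) i k *
  kern (a + b - x - x' + k%:R) (a + c - x - x' + k%:R) k j.
rewrite (@sum_ord_shift _ _ i j f) ?le_ij // => [|k]; last first.
  rewrite negb_and -!ltnNge /f => /orP[lt|lt].
    by rewrite kern_gt // mul0r.
  by rewrite (@kern_gt _ _ _ k j) // mulr0.
rewrite (@sum_ord_shift _ _ i j g) ?le_ij // => [|k]; last first.
  rewrite negb_and -!ltnNge /g => /orP[lt|lt].
    by rewrite kern_gt // mulr0 mul0r.
  by rewrite (@kern_gt _ _ _ k j) // mulr0.
apply: (mulIr (Fu (j - i)%N)).
set M := (j - i)%N; pose u := a - x + i%:R; pose v := a - x' + i%:R.
pose e := a + b - x - x' + i%:R.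
transitivity (\sum_(k < M.+1) 'C(M, k)%:R * (poch (e - v) k * poch u k *
    (poch (c - x') (M - k) * poch (e + k%:R) (M - k)))).
  rewrite mulr_suml; apply: eq_bigr => l _; have le_lM : (l <= M)%N by rewrite -ltnS.
  have le_il : (i + l <= j)%N by rewrite -leq_subRL.
  rewrite /f /kern leq_addr le_il addKn subnDA -/M natrD addrA -/u -/e.
  have -> : b - x = e - v by rewrite /e /v; ring.
  by rewrite divf_factM.
rewrite poch_sheppard.
rewrite mulr_suml; apply: eq_bigr => l _; have le_lM : (l <= M)%N by rewrite -ltnS.
have le_il : (i + l <= j)%N by rewrite -leq_subRL.
rewrite /g /kern leq_addr le_il addKn subnDA -/M natrD -/u -/v.
rewrite [(-1) ^+ l * (_ / _)]mulrA divf_factM //.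
have -> : a + c - x - x' + (i%:R + l%:R) = c - x' + u + l%:R by rewrite /u; ring.
by rewrite [_ + (i%:R + _)]addrA -/e; ring.
Qed.

(* Sum over [0 = k_0, k_1, ..., k_m = j] of the product of the [K s k_{s-1} k_s].
   The kernels below vanish when [k_s < k_{s-1}], so the bound [N] is harmless. *)
Fixpoint chain (F : pzSemiRingType) (N : nat) (K : nat -> nat -> nat -> F)
    (m j : nat) : F :=
  if m is s.+1 then \sum_(k < N.+1) chain N K s k * K s.+1 k j else (j == 0)%:R.

Lemma eq_chain (F : pzSemiRingType) N (K K' : nat -> nat -> nat -> F) m j :
  (forall s, (0 < s <= m)%N -> K s =2 K' s) -> chain N K m j = chain N K' m j.
Proof.
elim: m j => //= m IHm j eqK; apply: eq_bigr => k _.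
rewrite eqK ?leqnn // IHm // => s /andP[s0 le_sm].
by apply: eqK; rewrite s0 leqW.
Qed.

Lemma chain1 (F : pzSemiRingType) N (K : nat -> nat -> nat -> F) j :
  chain N K 1 j = K 1%N 0%N j.
Proof.
by rewrite /= big_ord_recl /= mul1r big1 ?addr0 // => k _; rewrite mul0r.
Qed.

Lemma chainSS (F : pzSemiRingType) N (K : nat -> nat -> nat -> F) m j :
  chain N K m.+2 j =
  \sum_(i < N.+1) chain N K m i * \sum_(k < N.+1) K m.+1 i k * K m.+2 k j.
Proof.
rewrite /=; under eq_bigr do rewrite mulr_suml.
rewrite exchange_big; apply: eq_bigr => i _ /=.
by rewrite mulr_sumr; apply: eq_bigr => k _; rewrite mulrA.
Qed.

(** * Chains of kernels: passage from A to B, symmetries, reflection *)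

Definition swapf (T : Type) (s : nat) (x : nat -> T) k :=
  if k == s then x s.+1 else if k == s.+1 then x s else x k.

Lemma swapf_id (T : Type) s (x : nat -> T) k : k != s -> k != s.+1 -> swapf s x k = x k.
Proof. by rewrite /swapf => /negbTE -> /negbTE ->. Qed.

Section Kernels.
Variables (F : comUnitRingType).
Implicit Types (x y : nat -> F).

Definition nu_fun x y (m : nat) : F := \sum_(1 <= k < m.+1) (y k - x k).

Definition psi_fun x y (m : nat) : F :=
  \sum_(1 <= j < m.+1) y j - \sum_(1 <= j < m) x j.

Definition kerA x y s i j := kern (y s.+1 - x s) (nu_fun x y s + i%:R) i j.

(** The two kernels of B. As [psi_fun x y s] involves neither [x s] nor [x s.+1], [kerX] is
    symmetric in these two; as [psi_fun x y s.+1] involves [y s] and [y s.+1] only through their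
    sum, [kerY] is symmetric in those. *)
Definition kerX x y s i j :=
  (-1) ^+ (j - i) *
  kern (psi_fun x y s - x s + i%:R) (psi_fun x y s - x s.+1 + i%:R) i j.

Definition kerY x y s i j :=
  kern (psi_fun x y s.+1 - y s + i%:R) (psi_fun x y s.+1 - y s.+1 + i%:R) i j.

(* At the last step [s = p - 1] the index [p + s] is odd: the steps alternate
   backwards from [kerY], which treats both parities of [p] at once. *)
Definition kerB p x y s := if odd (p + s) then kerY x y s else kerX x y s.

Lemma nu_fun0 x y : nu_fun x y 0 = 0.
Proof. by rewrite /nu_fun big_geq. Qed.

Lemma nu_funS x y m : nu_fun x y m.+1 = nu_fun x y m + (y m.+1 - x m.+1).
Proof. by rewrite /nu_fun big_nat_recr. Qed.

Lemma psi_funS x y m : psi_fun x y m.+1 = nu_fun x y m + y m.+1.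
Proof. by rewrite /psi_fun /nu_fun sumrB big_nat_recr //= addrAC. Qed.

Hypothesis Fu : forall k, (k`!%:R : F) \is a GRing.unit.

Lemma kerA_kerXY x y N m i j : (j <= N)%N ->
  \sum_(k < N.+1) kerA x y m.+1 i k * kerA x y m.+2 k j =
  \sum_(k < N.+1) kerX x y m.+1 i k * kerY x y m.+2 k j.
Proof.
(* [a] equals [psi_fun x y m.+1], and [a - x m.+1] is [nu_fun x y m.+1]. *)
move=> le_jN; pose a := nu_fun x y m + y m.+1.
have := @kern_two_step _ a (y m.+2) (y m.+3) (x m.+1) (x m.+2) N i j Fu le_jN.
congr (_ = _); apply: eq_bigr => k _; rewrite /kerA /kerX /kerY.
  by congr (kern _ _ _ _ * kern _ _ _ _); rewrite !nu_funS /a; ring.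
rewrite [in X in _ * X = _]kernC !psi_funS !nu_funS.
by congr (_ * kern _ _ _ _ * kern _ _ _ _); rewrite /a; ring.
Qed.

(** Kernels are exchanged in pairs from the end. For odd [m] the first kernel is left over; there
    [kerA] and [kerY] agree because the chain starts at [k_0 = 0]. *)
Lemma chain_kerAB p x y N m j : (j <= N)%N -> odd (p + m) ->
  chain N (kerA x y) m j = chain N (kerB p x y) m j.
Proof.
elim/ltn_ind: m j => -[//|[|m]] IHm j le_jN pm.
  rewrite !chain1 /kerB pm /kerA /kerY psi_funS !nu_funS nu_fun0.
  by congr kern; ring.
rewrite !chainSS; have pm' : odd (p + m) by rewrite !addnS /= negbK in pm.
apply: eq_bigr => i _; rewrite IHm // -1?ltnS //; congr (_ * _).
rewrite kerA_kerXY //; apply: eq_bigr => k _.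
by rewrite /kerB pm addnS /= pm'.
Qed.

(** For [m != s] the range of summation contains both [s] and [s.+1] or neither. *)
Lemma sum_swapf s x m : (0 < s)%N -> m != s ->
  \sum_(1 <= k < m.+1) swapf s x k = \sum_(1 <= k < m.+1) x k.
Proof.
move=> s0; elim/ltn_ind: m => -[|m] IHm; first by rewrite !big_geq.
move=> ne_ms; rewrite !(@big_nat_recr _ _ _ m.+1) //=.
have [eq_ms|ne_ms'] := eqVneq m s; last first.
  by rewrite IHm // swapf_id // eqSS.
case: s => // s in s0 eq_ms ne_ms IHm *; subst m.
rewrite !(@big_nat_recr _ _ _ s.+1) //= IHm //; last by rewrite neq_ltn leqnn.
rewrite /swapf !eqxx eqn_leq ltnn /=.
by rewrite -!addrA [x s.+2 + _]addrC.
Qed.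

Lemma nu_fun_swapl s x y m : (0 < s)%N -> m != s ->
  nu_fun (swapf s x) y m = nu_fun x y m.
Proof. by move=> s0 ms; rewrite /nu_fun !sumrB sum_swapf. Qed.

Lemma nu_fun_swapr s x y m : (0 < s)%N -> m != s ->
  nu_fun x (swapf s y) m = nu_fun x y m.
Proof. by move=> s0 ms; rewrite /nu_fun !sumrB sum_swapf. Qed.

(** Only the kernels [s] and [s.+1] see the exchange. Later kernels are peeled off until these two
    come last; their composite is then rewritten with [kerX] and [kerY], where the exchange only
    swaps the two parameters of [kerX]. *)
Lemma chain_swapx x y N s m j : (0 < s < m)%N -> (j <= N)%N ->
  chain N (kerA (swapf s x) y) m j = chain N (kerA x y) m j.
Proof.
case/andP; case: s => // s _; elim: m j => // m IHm j lt_sm le_jN.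
rewrite ltnS leq_eqVlt in lt_sm; case/orP: lt_sm => [/eqP eq_sm|lt_sm].
  rewrite -{}eq_sm !chainSS; apply: eq_bigr => i _; congr (_ * _).
    apply: eq_chain => t /andP[_ le_ts] i' j'.
    by rewrite /kerA nu_fun_swapl ?swapf_id //; lia.
  rewrite !kerA_kerXY //; apply: eq_bigr => k _.
  rewrite /kerX /kerY !psi_funS !nu_funS nu_fun_swapl //; last by lia.
  rewrite /swapf !eqxx eqn_leq ltnn /= [in X in _ * X * _ = _]kernC.
  by congr (_ * kern _ _ _ _ * kern _ _ _ _); ring.
rewrite /=; apply: eq_bigr => k _; rewrite IHm // -1?ltnS //.
by rewrite /kerA nu_fun_swapl ?swapf_id //; lia.
Qed.

(** As for [x], with the kernels [s.-1] and [s], the swap now taking place in [kerY]. For [s = 1]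
    there is no previous kernel, and the first one is symmetric because it starts at [0]. *)
Lemma chain_swapy x y N s m j : (0 < s <= m)%N -> (j <= N)%N ->
  chain N (kerA x (swapf s y)) m j = chain N (kerA x y) m j.
Proof.
case/andP=> s0; elim: m j => [|m IHm] j; first by lia.
move=> lt_sm le_jN.
rewrite leq_eqVlt in lt_sm; case/orP: lt_sm => [/eqP eq_sm|lt_sm]; last first.
  rewrite /=; apply: eq_bigr => k _; rewrite IHm // -1?ltnS //.
  by rewrite /kerA nu_fun_swapr ?swapf_id //; lia.
subst s; case: m s0 {IHm} => [|m] _.
  rewrite !chain1 /kerA !nu_funS !nu_fun0 !add0r !addr0 kernC.
  by rewrite /swapf.
rewrite !chainSS; apply: eq_bigr => i _; congr (_ * _).
  apply: eq_chain => t /andP[_ le_ts] i' j'.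
  by rewrite /kerA nu_fun_swapr ?swapf_id //; lia.
rewrite !kerA_kerXY //; apply: eq_bigr => k _.
rewrite /kerX /kerY !psi_funS !nu_funS nu_fun_swapr //; last by lia.
rewrite swapf_id; [|by lia|by lia].
rewrite /swapf !eqxx !(eqn_leq m.+3) ltnn /= [in X in _ * X = _]kernC.
by congr (_ * kern _ _ _ _ * kern _ _ _ _); ring.
Qed.

(* Both Pochhammer symbols of the last kernel are reflected, which exchanges
   them up to the same sign. *)
Lemma chain_reflect x x' y N m n : (0 < n)%N ->
  (forall k, (0 < k <= m)%N -> x' k = x k) ->
  x' m.+1 = nu_fun x y m.+1 + y m.+2 + n.-1%:R ->
  chain N (kerA x' y) m.+1 n = chain N (kerA x y) m.+1 n.
Proof.
move=> n0 eq_x x'm /=.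
have eq_nu s : (s <= m)%N -> nu_fun x' y s = nu_fun x y s.
  move=> le_sm; apply: eq_big_nat => k /andP[k0 le_ks]; rewrite eq_x //.
  by rewrite k0 (leq_trans _ le_sm).
apply: eq_bigr => k _; congr (_ * _).
  by apply: eq_chain => s /andP[s0 le_sm] i j; rewrite /kerA eq_nu // eq_x ?s0.
rewrite /kerA /kern; case: leqP => // le_kn; congr (_ / _).
have n1 : n.-1%:R = n%:R - 1 :> F by rewrite -[in RHS](prednK n0) -natr1 addrK.
rewrite !nu_funS eq_nu // {}x'm nu_funS n1.
(* By the choice of [x' m.+1], each new parameter and the opposite old one add up to
   [1 - (n - k)]. *)
rewrite (@poch_reflect _ (nu_fun x y m + (y m.+1 - x m.+1) + k%:R)); last first.
  by rewrite natrB //; ring.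
rewrite [in X in _ * X = _](@poch_reflect _ (y m.+2 - x m.+1)); last first.
  by rewrite natrB //; ring.
by rewrite mulrACA -expr2 sqrr_sign mul1r mulrC.
Qed.

End Kernels.

(** * Base change and non-negativity of chains *)

Lemma rmorph_poch (A B : pzSemiRingType) (f : {rmorphism A -> B}) (c : A) k :
  f (poch c k) = poch (f c) k.
Proof.
by rewrite rmorph_prod; apply: eq_bigr => i _; rewrite rmorphD rmorph_nat.
Qed.

(** This is what relates the polynomial to its image in the fraction field, to its values, and to
    real points: the chain uses only ring operations and inverses of factorials. *)
Lemma rmorph_chain_kerA (A B : comUnitRingType) (f : {rmorphism A -> B})
    (x y : nat -> A) N m j :
  (forall k, (k`!%:R : A) \is a GRing.unit) ->
  f (chain N (kerA x y) m j) = chain N (kerA (f \o x) (f \o y)) m j.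
Proof.
move=> Au; elim: m j => [|m IHm] j /=; first exact: rmorph_nat.
rewrite rmorph_sum; apply: eq_bigr => k _; rewrite rmorphM IHm; congr (_ * _).
rewrite /kerA /kern; case: leqP => _; last exact: rmorph0.
rewrite !rmorphM rmorphV ?Au // !rmorph_poch rmorph_nat rmorphB rmorphD rmorph_nat.
congr (_ * poch (_ + _) _ / _).
by rewrite rmorph_sum; apply: eq_bigr => i _; rewrite rmorphB.
Qed.

Lemma poch_ge0 (R : numDomainType) (c : R) k : 0 <= c -> 0 <= poch c k.
Proof. by move=> c0; apply: prodr_ge0 => i _; rewrite addr_ge0. Qed.

Lemma chain_kerA_ge0 (R : numFieldType) (x y : nat -> R) N m j :
  (forall s, (0 < s <= m)%N -> 0 <= nu_fun x y s /\ x s <= y s.+1) ->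
  0 <= chain N (kerA x y) m j.
Proof.
elim: m j => [|m IHm] j xy_ge0; first exact: ler0n.
apply: sumr_ge0 => k _; apply: mulr_ge0.
  by apply: IHm => s /andP[s0 le_sm]; apply: xy_ge0; rewrite s0 leqW.
have [|nu_ge0 xy] := xy_ge0 m.+1; first by rewrite leqnn.
rewrite /kerA /kern; case: leqP => // _.
by rewrite divr_ge0 // mulr_ge0 // poch_ge0 ?subr_ge0 // addr_ge0.
Qed.

(** * Row vectors and arbitrary permutations *)

Lemma perm_ind_adj n (P : 'S_n -> Prop) :
  P 1%g -> (forall s t, P s -> P t -> P (s * t)%g) ->
  (forall i j : 'I_n, j = i.+1 :> nat -> P (tperm i j)) -> forall s, P s.
Proof.
move=> P1 PM Padj.
(* A transposition at distance [d + 1] is the conjugate of one at distance [d] by an adjacent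
   one. *)
have Plt d (i j : 'I_n) : j = (i + d)%N :> nat -> P (tperm i j).
  elim: d j => [|d IHd] j eq_j.
    by rewrite (_ : j = i) ?tperm1 //; apply: val_inj; rewrite /= eq_j addn0.
  have lt_k : (i + d < n)%N by have := ltn_ord j; rewrite eq_j; lia.
  pose k := Ordinal lt_k; have [->|ne_ik] := eqVneq i k.
    by apply: Padj; rewrite eq_j addnS.
  have ne_ij : i != j by rewrite -val_eqE /= eq_j; lia.
  have -> : tperm i j = (tperm k j * (tperm i k * tperm k j))%g.
    by rewrite -{1}[tperm k j]tpermV -/(conjg _ _) tpermJ tpermL tpermD 1?eq_sym.
  by apply: (PM); [|apply: (PM)]; try (by apply: Padj; rewrite eq_j addnS); apply: IHd.
have Ptperm i j : P (tperm i j).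
  have [le_ij|/ltnW le_ji] := leqP i j.
    by apply: (Plt (j - i)%N); rewrite subnKC.
  by rewrite tpermC; apply: (Plt (i - j)%N); rewrite subnKC.
move=> s; have [ts -> _] := prod_tpermP s.
by elim/big_ind: _ => // -[i j] _; apply: Ptperm.
Qed.

Lemma vcompE (F : nmodType) m (v : 'rV[F]_m) (i : 'I_m) : vcomp v i.+1 = v 0 i.
Proof. by rewrite /vcomp /= valK. Qed.

Lemma vcomp_map (A B : nmodType) (f : {additive A -> B}) m (v : 'rV[A]_m) k :
  vcomp (map_mx f v) k = f (vcomp v k).
Proof. by rewrite /vcomp; case: insub => [i|]; rewrite ?mxE ?raddf0. Qed.

Lemma sum_vcomp (F : nmodType) m (v : 'rV[F]_m) :
  \sum_(1 <= k < m.+1) vcomp v k = \sum_(j < m) v 0 j.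
Proof.
by rewrite big_add1 big_mkord; apply: eq_bigr => i _; rewrite vcompE.
Qed.

Lemma vcomp_col_tperm (F : nmodType) m (v : 'rV[F]_m) (i j : 'I_m) k :
  j = i.+1 :> nat -> (0 < k <= m)%N ->
  vcomp (col_perm (tperm i j) v) k = swapf i.+1 (vcomp v) k.
Proof.
case: k => // k eq_j /= lt_km; pose q := Ordinal lt_km.
rewrite -[k]/(val q) vcompE mxE /swapf !eqSS -eq_j (vcompE v j) !val_eqE.
case: tpermP => [->|->|/eqP/negbTE-> /eqP/negbTE->]; rewrite ?eqxx ?vcompE //.
by rewrite -val_eqE /= eq_j vcompE eqn_leq ltnn.
Qed.

Lemma eq_chain_kerA (F : comUnitRingType) (x x' y y' : nat -> F) N m j :
  (forall k, (0 < k <= m)%N -> x k = x' k) ->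
  (forall k, (0 < k <= m.+1)%N -> y k = y' k) ->
  chain N (kerA x y) m j = chain N (kerA x' y') m j.
Proof.
move=> eq_x eq_y; apply: eq_chain => s /andP[s0 le_sm] a b; rewrite /kerA.
rewrite eq_y // eq_x ?s0 //; congr (kern _ (_ + _) _ _).
apply: eq_big_nat => k /andP[k0 le_ks].
have le_km : (k <= m)%N := @leq_trans s k m le_ks le_sm.
by rewrite eq_y ?eq_x ?k0 // leqW.
Qed.

Section Symmetry.
Variables (F : comUnitRingType) (m N : nat).
Implicit Types (x : 'rV[F]_m) (y : 'rV[F]_m.+1).
Hypothesis Fu : forall k, (k`!%:R : F) \is a GRing.unit.

(** Here [m] is [p - 1], and [N] is both the endpoint [n] and the bound of the sums. *)
Definition chainA x y : F := chain N (kerA (vcomp x) (vcomp y)) m N.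

Lemma chainA_permx x y s : chainA (col_perm s x) y = chainA x y.
Proof.
elim/perm_ind_adj: s x => [x|s t IHs IHt x|i j eq_j x].
- by rewrite col_perm1.
- by rewrite col_permM IHs.
- rewrite /chainA -(@chain_swapx _ Fu (vcomp x) _ N i.+1) //; last first.
    by rewrite /= -eq_j ltn_ord.
  by apply: eq_chain_kerA => // k k_m; rewrite vcomp_col_tperm.
Qed.

Lemma chainA_permy x y s : chainA x (col_perm s y) = chainA x y.
Proof.
elim/perm_ind_adj: s y => [y|s t IHs IHt y|i j eq_j y].
- by rewrite col_perm1.
- by rewrite col_permM IHs.
- rewrite /chainA -(@chain_swapy _ Fu _ (vcomp y) N i.+1) //; last first.
    by rewrite /= -ltnS -eq_j ltn_ord.
  by apply: eq_chain_kerA => // k k_m; rewrite vcomp_col_tperm.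
Qed.

End Symmetry.

Lemma chainA_drop_append (F : fieldType) m n (x : 'rV[F]_m)
    (y : 'rV[F]_m.+1) (w : 'I_m) :
  (forall k, (k`!%:R : F) \is a GRing.unit) ->
  chainA n.+1 (drop_append x w (@nu_total F m.+1 x y + n%:R)) y =
  chainA n.+1 x y.
Proof.
move=> Fu; case: m => [|m] in x y w *; first by case: w.
(* This permutation moves the component [w] to the end and keeps the order of the others. *)
rewrite -[RHS](@chainA_permx _ _ _ Fu x y (lift_perm ord_max w 1)).
apply: chain_reflect => // [k /andP[k0 le_km]|].
  have lt_k : (k.-1 < m.+1)%N by lia.
  rewrite -(prednK k0) (vcompE _ (Ordinal lt_k)) (vcompE _ (Ordinal lt_k)) !mxE /=.
  rewrite prednK // ltn_eqF //.
  have lt_k' : (k.-1 < m)%N by lia.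
  have -> : Ordinal lt_k = lift ord_max (Ordinal lt_k').
    by apply: val_inj; rewrite /= /bump leqNgt lt_k'.
  by rewrite lift_perm_lift perm1 -vcompE.
(* It remains to see that the total [nu] is unchanged by permuting [x]. *)
rewrite [LHS](vcompE _ ord_max) mxE /= eqxx; congr (_ + _).
rewrite /nu_total /nu_fun sumrB addrAC -big_nat_recr //=.
rewrite !sum_vcomp; congr (_ - _).
rewrite (reindex_inj (@perm_inj _ (lift_perm ord_max w 1))) /=.
by apply: eq_bigr => i _; rewrite mxE.
Qed.

Lemma rmorph_chainA (A B : comUnitRingType) (f : {rmorphism A -> B}) m N
    (x : 'rV[A]_m) (y : 'rV[A]_m.+1) :
  (forall k, (k`!%:R : A) \is a GRing.unit) ->
  chainA N (map_mx f x) (map_mx f y) = f (chainA N x y).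
Proof.
move=> Au; rewrite [RHS]rmorph_chain_kerA //.
by apply: eq_chain_kerA => k _; rewrite vcomp_map.
Qed.

(** * From multi-indices to chains *)

Section Multiindex.
Variables (N : nat).

Lemma lcE m (l : mindex m.+2 N) (i : 'I_m) : lc l i.+1 = l i.
Proof. by rewrite /lc /= valK. Qed.

Definition rcons_mindex m (la : mindex m.+2 N * 'I_N.+1) : mindex m.+3 N :=
  [ffun i => if unlift ord_max i is Some j then la.1 j else la.2].

Lemma rcons_mindex_bij m : bijective (@rcons_mindex m).
Proof.
exists (fun l : mindex m.+3 N => ([ffun i => l (lift ord_max i)], l ord_max)).
- case=> l a; congr pair; last by rewrite ffunE unlift_none.
  by apply/ffunP => i; rewrite !ffunE liftK.
- move=> l; apply/ffunP => i; rewrite !ffunE /=.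
  by case: unliftP => [j|] -> //; rewrite ffunE.
Qed.

Lemma lc_rcons m l a s : (0 < s <= m)%N -> lc (@rcons_mindex m (l, a)) s = lc l s.
Proof.
case: s => // s lt_sm; pose i := @Ordinal m s lt_sm.
rewrite -[s in RHS]/(val i) lcE.
have -> : s = lift ord_max i by rewrite /= /bump leqNgt (lt_sm : (s < m)%N).
by rewrite lcE ffunE liftK.
Qed.

Lemma lc_rcons_last m l a : lc (@rcons_mindex m (l, a)) m.+1 = a.
Proof. by rewrite -[m]/(val (@ord_max m)) lcE ffunE unlift_none. Qed.

(** The plain partial sums; [lsum] agrees with them except at the last index, where it is [n]. *)
Definition psum (c : nat -> nat) s := (\sum_(1 <= i < s.+1) c i)%N.

Lemma psumS c s : psum c s.+1 = (psum c s + c s.+1)%N.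
Proof. by rewrite /psum big_nat_recr. Qed.

Lemma eq_psum c c' s :
  (forall i, (0 < i <= s)%N -> c i = c' i) -> psum c s = psum c' s.
Proof. by move=> eq_c; apply: eq_big_nat => i /andP[i0 le_is]; apply: eq_c; rewrite i0. Qed.

Lemma sum_eq_ord (F : pzSemiRingType) (c : nat) (f : nat -> F) :
  (forall k, (N < k)%N -> f k = 0) ->
  \sum_(k < N.+1) (c == k)%:R * f k = f c.
Proof.
move=> f0; have [le_cN|lt_Nc] := leqP c N; last first.
  rewrite f0 // big1 // => k _; rewrite gtn_eqF ?mul0r //.
  by apply: leq_trans lt_Nc; rewrite ltn_ord.
have lt_c : (c < N.+1)%N by [].
rewrite (bigD1 (Ordinal lt_c)) //= eqxx mul1r big1 ?addr0 // => k.
by rewrite -val_eqE /= eq_sym => /negbTE ->; rewrite mul0r.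
Qed.

(** The substitution [l_s = k_s - k_{s-1}], by induction on the last component; the indicator fixes
    the end of the chain. Sequences that decrease somewhere come from no multi-index, but there [K]
    vanishes. *)
Lemma sum_mindex_chain (F : comPzRingType) (K : nat -> nat -> nat -> F) m j :
  (j <= N)%N -> (forall s i k, (k < i)%N -> K s i k = 0) ->
  \sum_(l : mindex m.+2 N) (psum (lc l) m == j)%:R *
    \prod_(1 <= s < m.+1) K s (psum (lc l) s.-1) (psum (lc l) s) =
  chain N K m j.
Proof.
move=> le_jN K0; elim: m j le_jN => [|m IHm] j le_jN.
  rewrite (eq_bigr (fun=> (0%N == j)%:R)) => [|l _]; last first.
    by rewrite /psum !big_geq // mulr1.
  by rewrite sumr_const card_ffun !card_ord expn0 eq_sym.
rewrite (reindex (@rcons_mindex m)) /=; last exact: onW_bij (rcons_mindex_bij m).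
rewrite (eq_bigr (fun la : mindex m.+2 N * 'I_N.+1 =>
   (psum (lc la.1) m + la.2 == j)%N%:R *
   (\prod_(1 <= s < m.+1) K s (psum (lc la.1) s.-1) (psum (lc la.1) s) *
    K m.+1 (psum (lc la.1) m) j))); last first.
  case=> l a _ /=; set c := lc (rcons_mindex _).
  have eq_c s : (s <= m)%N -> psum c s = psum (lc l) s.
    move=> le_sm; apply: eq_psum => i /andP[i0 le_is].
    by rewrite /c lc_rcons // i0 (leq_trans le_is).
  rewrite psumS /c lc_rcons_last -/c eq_c //; case: eqP => [eq_j|_]; last by rewrite !mul0r.
  rewrite big_nat_recr //= psumS /c lc_rcons_last -/c eq_c // eq_j; congr (_ * (_ * _)).
  apply: eq_big_nat => s /andP[s0 le_sm]; rewrite !eq_c //.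
  by rewrite (leq_trans (leq_pred s)).
rewrite -(pair_bigA _ (fun l (a : 'I_N.+1) => (psum (lc l) m + a == j)%N%:R *
   (\prod_(1 <= s < m.+1) K s (psum (lc l) s.-1) (psum (lc l) s) *
    K m.+1 (psum (lc l) m) j))) /=.
under [RHS]eq_bigr => k _ do rewrite -IHm -1?ltnS // mulr_suml.
rewrite [RHS]exchange_big; apply: eq_bigr => l _ /=.
pose P := \prod_(1 <= s < m.+1) K s (psum (@lc m.+2 N l) s.-1) (psum (@lc m.+2 N l) s).
rewrite -/P; set c := psum _ m.
under [RHS]eq_bigr do rewrite -mulrA.
rewrite (@sum_eq_ord _ c (fun k => P * K m.+1 k j)) => [|k lt_Nk]; last first.
  by rewrite K0 ?mulr0 // (leq_ltn_trans le_jN).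
have [le_cj|lt_jc] := leqP c j; last by rewrite K0 // mulr0 big1 // => a _; rewrite mulr0.
(* From [c] the only last component reaching [j] is [j - c], which is in range since [j <= N]. *)
have le_N : (j - c < N.+1)%N by rewrite ltnS (leq_trans (leq_subr _ _)).
rewrite (bigD1 (Ordinal le_N)) //= subnKC // eqxx mul1r big1 ?addr0 // => a.
rewrite -val_eqE /= => /negbTE ne_a.
have -> : (c + a == j)%N = false by apply/negbTE; apply: contraFneq ne_a => <-; rewrite addKn.
by rewrite mul0r.
Qed.

(** The last step to [N] corresponds to no component of [l]; multi-indices of sum above [N] are
    killed by the last kernel. *)
Lemma sum_lsum_chain (F : comPzRingType) (K : nat -> nat -> nat -> F) m :
  (forall s i k, (k < i)%N -> K s i k = 0) ->
  \sum_(l : mindex m.+2 N) \prod_(1 <= s < m.+2) K s (lsum l s.-1) (lsum l s) =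
  chain N K m.+1 N.
Proof.
move=> K0 /=.
under [RHS]eq_bigr => k _ do rewrite -sum_mindex_chain -1?ltnS // mulr_suml.
rewrite [RHS]exchange_big; apply: eq_bigr => l _ /=.
under [RHS]eq_bigr do rewrite -mulrA.
pose P := \prod_(1 <= s < m.+1) K s (psum (@lc m.+2 N l) s.-1) (psum (@lc m.+2 N l) s).
rewrite -/P.
rewrite (@sum_eq_ord _ _ (fun k => P * K m.+1 k N)) => [|k lt_Nk]; last first.
  by rewrite K0 ?mulr0.
rewrite big_nat_recr //=; congr (_ * _); last by rewrite /lsum /= ltnn leqnn.
apply: eq_big_nat => s /andP[s0 le_sm].
by rewrite /lsum /= le_sm (leq_ltn_trans (leq_pred s)).
Qed.

End Multiindex.

(** * Terms of the two series as products of kernels *)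

Lemma prod_pair_odd (F : comPzRingType) (G : nat -> F) p : odd p ->
  \prod_(1 <= s < p) G s = \prod_(2 <= m < p | ~~ odd m) (G m.-1 * G m).
Proof.
move=> odd_p; rewrite -[p]odd_double_half odd_p add1n; elim: p./2 => [|r IHr].
  by rewrite !big_geq.
rewrite doubleS 2?big_nat_recr //= {}IHr.
rewrite [RHS]big_mkcond big_nat_recr //= odd_double /= mulrA; congr (_ * _ * _).
case: r => [|r]; first by rewrite !big_geq.
by rewrite [RHS]big_nat_recr //= odd_double /= mulr1 -big_mkcond.
Qed.

Lemma prod_pair_even (F : comPzRingType) (G : nat -> F) p : ~~ odd p -> (1 < p)%N ->
  \prod_(1 <= s < p) G s =
  G 1%N * \prod_(2 <= m < p.-1 | ~~ odd m) (G m * G m.+1).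
Proof.
case: p => [//|p] /= odd_p p_gt0; rewrite negbK in odd_p.
rewrite big_ltn // big_add1 /= (prod_pair_odd (fun s => G s.+1)) //.
congr (_ * _); rewrite big_nat_cond [RHS]big_nat_cond.
by apply: eq_bigr => m /andP[/andP[m1 _] _]; rewrite prednK // ltnW.
Qed.

Section Terms.
Variables (F : fieldType) (N m : nat).
Hypothesis F0 : forall k, (k`!%:R : F) != 0.
Implicit Types (x y : nat -> F) (c : nat -> nat).

Lemma poch_div (a : F) i j : (i <= j)%N -> poch a i != 0 ->
  poch a j / poch a i = poch (a + i%:R) (j - i).
Proof. by move=> le_ij a0; rewrite -{1}(subnKC le_ij) pochD mulrC mulKf. Qed.

(** Telescoping: splitting [(nu_s)_{|l_s|}] at [|l_{s-1}|] cancels the previous denominator. The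
    extra factor on the left compensates the last denominator. *)
Lemma prod_kerA x y c r :
  (forall s k, (0 < s <= r.+1)%N -> poch (nu_fun x y s) k != 0) ->
  \prod_(1 <= s < r.+1)
     ((poch (nu_fun x y s) (psum c s) * poch (y s.+1 - x s) (c s)) /
      (poch (nu_fun x y s.+1) (psum c s) * (c s)`!%:R)) *
  poch (nu_fun x y r.+1) (psum c r) =
  \prod_(1 <= s < r.+1) kerA x y s (psum c s.-1) (psum c s).
Proof.
elim: r => [|r IHr] nu0.
  by rewrite !big_geq // /psum big_geq // poch0 mulr1.
rewrite big_nat_recr //= [in RHS]big_nat_recr //= -IHr; last first.
  by move=> s k /andP[s0 le_sr]; apply: nu0; rewrite s0 leqW.
rewrite /kerA /kern psumS leq_addr addKn pochD.
have := nu0 r.+2 (psum c r + c r.+1)%N; have := F0 (c r.+1).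
move=> c0 /(_ (leqnn _)) nu_neq0.
by field; rewrite c0 nu_neq0.
Qed.

(** With [k = |l_m|], [(nu_{m+1})_N] is split at [k] between the telescoping product and the last
    kernel. Reflecting the last [k] factors of [(y_{m+2} - x_{m+1})_N] cancels the denominator, with
    the same sign as [(-N)_k]. *)
Lemma termA x y c : (psum c m <= N)%N ->
  (forall s k, (0 < s <= m.+1)%N -> poch (nu_fun x y s) k != 0) ->
  (forall k, (k <= N)%N -> poch (1 - y m.+2 + x m.+1 - N%:R) k != 0) ->
  poch (nu_fun x y m.+1) N * poch (y m.+2 - x m.+1) N / N`!%:R *
    (poch (- N%:R) (psum c m) / poch (1 - y m.+2 + x m.+1 - N%:R) (psum c m) *
     \prod_(1 <= s < m.+1)
       ((poch (nu_fun x y s) (psum c s) * poch (y s.+1 - x s) (c s)) /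
        (poch (nu_fun x y s.+1) (psum c s) * (c s)`!%:R))) =
  \prod_(1 <= s < m.+1) kerA x y s (psum c s.-1) (psum c s) *
  kerA x y m.+1 (psum c m) N.
Proof.
move=> le_kN nu0 d0; rewrite -prod_kerA // /kerA /kern le_kN.
set P := \prod_(1 <= s < _) _; set k := psum c m in le_kN *.
set a := nu_fun x y m.+1; set d := y m.+2 - x m.+1.
rewrite -{1}(subnKC le_kN) pochD.
have -> : poch d N = poch d (N - k) *
    ((-1) ^+ k * poch (1 - y m.+2 + x m.+1 - N%:R) k).
  rewrite -{1}(subnK le_kN) pochD; congr (_ * _); apply: poch_reflect.
  by rewrite /d natrB //; ring.
have := @poch_opp_nat F N k; rewrite le_kN => eq_k.
have -> : poch (- N%:R) k = (-1) ^+ k * N`!%:R / (N - k)`!%:R :> F.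
  by rewrite -eq_k mulfK.
have := sqrr_sign F k; set e := (-1) ^+ k => e2.
have := F0 N; have := F0 (N - k)%N; have := d0 k le_kN.
set D := poch _ k => D0 Nk0 N0.
transitivity (e ^+ 2 * (P * poch a k * (poch d (N - k) *
   poch (a + k%:R) (N - k) / (N - k)`!%:R))).
  by field; rewrite D0 Nk0 N0.
by rewrite e2 mul1r.
Qed.

(** [ratX] and [ratY] are the kernels of B without sign and factorial, as the quotients that occur
    in the series. *)
Definition ratX x y (k : nat -> nat) s : F :=
  (poch (psi_fun x y s - x s) (k s) / poch (psi_fun x y s - x s) (k s.-1)) *
  (poch (psi_fun x y s - x s.+1) (k s) / poch (psi_fun x y s - x s.+1) (k s.-1)).

Definition ratY x y (k : nat -> nat) s : F :=
  (poch (psi_fun x y s.+1 - y s) (k s) / poch (psi_fun x y s.+1 - y s) (k s.-1)) *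
  (poch (psi_fun x y s.+1 - y s.+1) (k s) / poch (psi_fun x y s.+1 - y s.+1) (k s.-1)).

Definition ratB p x y k s : F := if odd (p + s) then ratY x y k s else ratX x y k s.

Definition nonzeroB x y :=
  forall s k, (0 < s <= m.+1)%N ->
    [/\ poch (psi_fun x y s - x s) k != 0,
        poch (psi_fun x y s - x s.+1) k != 0,
        poch (psi_fun x y s.+1 - y s) k != 0
      & poch (psi_fun x y s.+1 - y s.+1) k != 0].

Lemma prod_kerB p x y (k : nat -> nat) : nonzeroB x y ->
  (forall s, (0 < s <= m.+1)%N -> (k s.-1 <= k s)%N) ->
  \prod_(1 <= s < m.+2) kerB p x y s (k s.-1) (k s) =
  \prod_(1 <= s < m.+2) ((if odd (p + s) then 1 else (-1) ^+ (k s - k s.-1)) /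
                         (k s - k s.-1)`!%:R) *
  \prod_(1 <= s < m.+2) ratB p x y k s.
Proof.
move=> nz mono; rewrite -big_split; apply: eq_big_nat => s s_m /=.
have [n1 n2 n3 n4] := nz s (k s.-1) s_m; have le_k := mono s s_m.
rewrite /kerB /ratB; case: ifP => _.
  by rewrite /kerY /kern le_k /ratY !poch_div //; ring.
by rewrite /kerX /kern le_k /ratX !poch_div //; ring.
Qed.

(** [(-N)_k] contributes a sign for every component; the explicit sign removes it where [p + i] is
    odd, leaving exactly the signs of [kerX]. The remaining [(N - k)!] belongs to the last
    kernel. *)
Lemma sign_prod p c (P : pred nat) : odd p = odd m ->
  (forall i, P i = odd (p + i)) -> (psum c m <= N)%N ->
  poch (- N%:R) (psum c m) * (-1) ^+ (\sum_(1 <= i < m | P i) c i)%N /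
    ((\prod_(1 <= i < m.+1) (c i)`!%:R) * N`!%:R) =
  \prod_(1 <= s < m.+1) ((if odd (p + s) then 1 else (-1) ^+ c s) / (c s)`!%:R)
  / (N - psum c m)`!%:R :> F.
Proof.
move=> pm PE le_kN.
(* The index [m] may be added to the exponent's range: [p + m] is even, so [P m] fails. *)
have eq_sum : (\sum_(1 <= i < m | P i) c i = \sum_(1 <= i < m.+1 | P i) c i)%N.
  case: {le_kN} m pm => [|r] pr; first by rewrite !big_geq.
  rewrite [RHS]big_mkcond big_nat_recr //= -big_mkcond PE oddD pr addbb.
  by rewrite addn0.
have := @poch_opp_nat F N (psum c m); rewrite le_kN => eq_k.
have -> : poch (- N%:R) (psum c m) = (-1) ^+ psum c m * N`!%:R / (N - psum c m)`!%:R :> F.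
  by rewrite -eq_k mulfK.
rewrite big_split prodfV /=.
have -> : \prod_(1 <= i < m.+1) (if odd (p + i) then 1 else (-1) ^+ c i) =
          (-1) ^+ psum c m * (-1) ^+ (\sum_(1 <= i < m | P i) c i)%N :> F.
  rewrite eq_sum /psum !(big_morph _ (exprD (-1)) (expr0 (-1))).
  rewrite [X in _ * X]big_mkcond -big_split /=.
  apply: eq_bigr => i _; rewrite PE; case: ifP => _; last by rewrite mulr1.
  by rewrite -expr2 sqrr_sign.
have Pn0 : \prod_(1 <= i < m.+1) (c i)`!%:R != 0 :> F.
  by rewrite prodf_seq_neq0; apply/allP => i _; rewrite F0.
set Q := \prod_(1 <= i < _) _ in Pn0 *.
by field; rewrite Pn0 !F0.
Qed.

End Terms.

Section SeriesChain.
Variables (F : fieldType) (m N : nat) (x : 'rV[F]_m.+1) (y : 'rV[F]_m.+2).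
Hypothesis F0 : forall k, (k`!%:R : F) != 0.

Lemma lsumE (l : mindex m.+2 N) s : (s <= m)%N -> lsum l s = psum (lc l) s.
Proof. by rewrite /lsum /= ltnS => ->. Qed.

Lemma lsum_last (l : mindex m.+2 N) : lsum l m.+1 = N.
Proof. by rewrite /lsum /= ltnn. Qed.

Lemma poch_opp_nat_gt k : (N < k)%N -> poch (- N%:R) k = 0 :> F.
Proof.
move=> lt_Nk; have := @poch_opp_nat F N k; rewrite leqNgt lt_Nk /=.
by move=> /eqP; rewrite mulf_eq0 (negbTE (F0 _)) orbF => /eqP.
Qed.

Lemma seriesA_chain :
  (forall s k, (0 < s <= m.+1)%N -> poch (@nu_ F m.+2 x y s) k != 0) ->
  (forall k, (k <= N)%N ->
     poch (1 - vcomp y m.+2 + vcomp x m.+1 - N%:R) k != 0) ->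
  @seriesA F m.+2 N x y = chainA N x y.
Proof.
move=> nu0 d0; rewrite /chainA -sum_lsum_chain; last by move=> *; apply: kern_gt.
rewrite /seriesA mulr_sumr; apply: eq_bigr => l _.
rewrite [RHS]big_nat_recr //= lsum_last lsumE //.
rewrite [X in _ = X * _](eq_big_nat _ _ (F2 := fun s => kerA (vcomp x) (vcomp y) s
    (psum (lc l) s.-1) (psum (lc l) s))); last first.
  by move=> s /andP[s0 le_sm]; rewrite !lsumE // (leq_trans (leq_pred s)).
(* Beyond [N] both sides vanish: the left by [(-N)_k], the right by the last kernel. *)
have [lt_Nk|le_kN] := ltnP N (psum (lc l) m).
  by rewrite poch_opp_nat_gt // /kerA kern_gt // !(mul0r, mulr0).
rewrite -termA //; congr (_ * (_ * _)).
by apply: eq_big_nat => s /andP[s0 le_sm]; rewrite lsumE.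
Qed.

Lemma seriesB_chain : nonzeroB m (vcomp x) (vcomp y) -> (0 < m)%N ->
  @seriesB F m.+2 N x y = chainA N x y.
Proof.
move=> nz m0; rewrite /chainA (@chain_kerAB _ _ m.+2) //; first last.
- by rewrite addSn addnS /= negbK addnn odd_double.
- by move=> k; rewrite unitfE.
rewrite -sum_lsum_chain; last first.
  move=> s i k lt_ki; rewrite /kerB /kerY /kerX.
  by case: ifP => _; rewrite kern_gt // mulr0.
rewrite /seriesB /seriesB_odd /seriesB_even.
set z := vcomp x; set t := vcomp y; rewrite -/z -/t in nz.
(* Common to both parities: [P] selects the exponent of the sign and [pr] stands for the Pochhammer
   quotients. *)
have eqB (l : mindex m.+2 N) (pr : F) (P : pred nat) :
    (forall i, P i = odd (m.+2 + i)) ->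
    ((psum (lc l) m <= N)%N ->
      pr = \prod_(1 <= s < m.+2) ratB m.+2 z t (lsum l) s) ->
    poch (- N%:R) (lsum l m) * (-1) ^+ (\sum_(1 <= i < m | P i) lc l i)%N /
      ((\prod_(1 <= i < m.+1) (lc l i)`!%:R) * N`!%:R) * pr =
    \prod_(1 <= s < m.+2) kerB m.+2 z t s (lsum l s.-1) (lsum l s) :> F.
  move=> PE; have [lt_Nk _|le_kN ->//] := ltnP N (psum (lc l) m).
    rewrite [RHS]big_nat_recr //= lsum_last lsumE // poch_opp_nat_gt //.
    rewrite /kerB /kerX /kerY.
    by case: ifP => _; rewrite kern_gt // !(mul0r, mulr0).
  have mono s : (0 < s <= m.+1)%N -> (lsum l s.-1 <= lsum l s)%N.
    case: s => // s; rewrite andTb => le_sm; rewrite [lsum l s.+1.-1]lsumE //.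
    move: le_sm; rewrite leq_eqVlt eqSS => /orP[/eqP->|lt_sm]; first by rewrite lsum_last.
    by rewrite lsumE // psumS leq_addr.
  rewrite prod_kerB //; congr (_ * _); rewrite lsumE // (@sign_prod _ _ _ F0 m.+2) //.
    have odd_m : odd (m.+2 + m.+1) by rewrite addSn addnS /= negbK addnn odd_double.
    rewrite [RHS]big_nat_recr // odd_m lsum_last lsumE // mul1r; congr (_ / _).
    apply: eq_big_nat => s /andP[s0 le_sm]; case: s s0 le_sm => // s _ lt_sm.
    by rewrite [lsum l s.+1.-1]lsumE ?lsumE ?psumS ?addKn // ltnW.
  by rewrite /= negbK.
case: ifP => [odd_m|/negbT even_m].
  apply: eq_bigr => l _; apply: eqB => [i|le_kN].
    by rewrite oddD odd_m.
  rewrite (prod_pair_odd _ odd_m) big_nat_cond [RHS]big_nat_cond.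
  apply: eq_bigr => q /andP[/andP[q2 q_m] even_q].
  rewrite /ratB.
  have -> : odd (m.+2 + q) by rewrite oddD odd_m addTb.
  have -> : odd (m.+2 + q.-1) = false.
    case: q q2 even_q {q_m} => // q _; rewrite [odd q.+1]/= negbK => odd_q.
    by rewrite oddD odd_m odd_q.
  rewrite /ratX /ratY prednK; last by rewrite ltnW.
  by rewrite !invfM; ring.
apply: eq_bigr => l _; rewrite -mulrA; apply: eqB => [i|le_kN].
  by rewrite oddD (negbTE even_m).
rewrite (prod_pair_even _ even_m) //; congr (_ * _).
  (* The unpaired first kernel gives the separate factor in [l_1]: its denominators are [1] since
     [k_0 = 0]. *)
  rewrite /ratB oddD (negbTE even_m) /= /ratY /= !lsumE //.
  by rewrite psumS /psum !big_geq // add0n !poch0 !divr1 mulrC.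
rewrite big_nat_cond [RHS]big_nat_cond.
apply: eq_bigr => q /andP[/andP[q2 q_m] even_q].
rewrite /ratB !oddD (negbTE even_m) /= (negbTE even_q) /= /ratX /ratY /=.
by rewrite !invfM; ring.
Qed.

End SeriesChain.

(** * The series at the generic point *)

Lemma poch_neq0 (R : numDomainType) (c : R) k : 0 < c -> poch c k != 0.
Proof.
move=> c0; apply/lt0r_neq0; apply: prodr_gt0 => i _.
by rewrite ltr_wpDr.
Qed.

Section Generic.
Variables (C : numFieldType) (m : nat).
Local Notation P := {mpoly C[m.+1 + m.+2]}.
Local Notation frac := (@FracField.tofrac P).

(** The indeterminates before passing to fractions: a chain computed here is a polynomial by
    construction. *)
Definition polyx : 'rV[P]_m.+1 := \row_i 'X_(lshift m.+2 i).
Definition polyy : 'rV[P]_m.+2 := \row_j 'X_(rshift m.+1 j).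

Lemma genxE : genx C m.+2 = map_mx frac polyx.
Proof. by apply/rowP => i; rewrite !mxE. Qed.

Lemma genyE : geny C m.+2 = map_mx frac polyy.
Proof. by apply/rowP => i; rewrite !mxE. Qed.

Lemma fact_unit (A : comUnitRingType) (f : {rmorphism C -> A}) k :
  (k`!%:R : A) \is a GRing.unit.
Proof.
rewrite -(rmorph_nat f) rmorph_unit // unitfE pnatr_eq0 -lt0n.
exact: fact_gt0.
Qed.

Lemma evalxy_chainA N (x : 'rV[C]_m.+1) (y : 'rV[C]_m.+2) :
  @evalxy C m.+2 (chainA N polyx polyy) x y = chainA N x y.
Proof.
rewrite /evalxy -rmorph_chainA; last exact: (fact_unit (@mpolyC _ C)).
congr (chainA _ _ _).
  by apply/rowP => i; rewrite mxE [polyx _ _]mxE /= mevalXU row_mxEl.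
by apply/rowP => i; rewrite mxE [polyy _ _]mxE /= mevalXU row_mxEr.
Qed.

(* The nonvanishing of the denominators is checked at [x = 0], [y = 1]. *)
Definition ev01 : P -> C :=
  meval (row_mx (0 : 'rV[C]_m.+1) (const_mx 1 : 'rV[C]_m.+2) 0).

Lemma frac_neq0 (q : P) : ev01 q != 0 -> frac q != 0.
Proof. by apply: contra; rewrite tofrac_eq0 => /eqP->; rewrite /ev01 meval0. Qed.

Lemma ev01_x k : ev01 (vcomp polyx k) = 0.
Proof.
rewrite /vcomp; case: insub => [i|]; last by rewrite /ev01 meval0.
by rewrite mxE /ev01 mevalXU row_mxEl mxE.
Qed.

Lemma ev01_y k : (0 < k <= m.+2)%N -> ev01 (vcomp polyy k) = 1.
Proof.
case: k => // k lt_k; rewrite (vcompE _ (@Ordinal m.+2 k lt_k)) mxE.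
by rewrite /ev01 mevalXU row_mxEr mxE.
Qed.

Lemma ev01_sumy s : (s <= m.+2)%N ->
  ev01 (\sum_(1 <= k < s.+1) vcomp polyy k) = s%:R.
Proof.
move=> le_s; rewrite /ev01 rmorph_sum (eq_big_nat _ _ (F2 := fun=> 1)).
  by rewrite sumr_const_nat subn1.
by move=> k /andP[k0 le_ks]; apply: ev01_y; rewrite k0 (leq_trans _ le_s).
Qed.

Lemma ev01_sumx a b : ev01 (\sum_(a <= k < b) vcomp polyx k) = 0.
Proof. by rewrite /ev01 rmorph_sum big1 // => k _; apply: ev01_x. Qed.

Lemma frac_poch_neq0 (q : P) k : 0 < ev01 q -> poch (frac q) k != 0.
Proof.
move=> q0; rewrite -rmorph_poch frac_neq0 // /ev01 rmorph_poch.
exact: poch_neq0.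
Qed.

Lemma ev01_psi s : (s <= m.+2)%N ->
  ev01 (psi_fun (vcomp polyx) (vcomp polyy) s) = s%:R.
Proof.
move=> le_s; rewrite /psi_fun /ev01 rmorphB.
by rewrite [X in X - _]ev01_sumy // [X in _ - X]ev01_sumx subr0.
Qed.

Lemma gen_vcompx k : vcomp (genx C m.+2) k = frac (vcomp polyx k).
Proof. by rewrite genxE vcomp_map. Qed.

Lemma gen_vcompy k : vcomp (geny C m.+2) k = frac (vcomp polyy k).
Proof. by rewrite genyE vcomp_map. Qed.

Lemma gen_nu s :
  nu_ (genx C m.+2) (geny C m.+2) s = frac (nu_fun (vcomp polyx) (vcomp polyy) s).
Proof.
rewrite rmorph_sum; apply: eq_bigr => k _.
by rewrite gen_vcompx gen_vcompy rmorphB.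
Qed.

Lemma gen_psi s : psi_fun (vcomp (genx C m.+2)) (vcomp (geny C m.+2)) s =
  frac (psi_fun (vcomp polyx) (vcomp polyy) s).
Proof.
rewrite rmorphB !rmorph_sum; congr (_ - _); apply: eq_bigr => k _.
  exact: gen_vcompy.
exact: gen_vcompx.
Qed.

Lemma fact_neq0 (A : fieldType) (f : {rmorphism C -> A}) k : (k`!%:R : A) != 0.
Proof. by rewrite -unitfE; apply: (fact_unit f). Qed.

Lemma gen_chainA N :
  chainA N (genx C m.+2) (geny C m.+2) = frac (chainA N polyx polyy).
Proof.
rewrite genxE genyE rmorph_chainA //; exact: (fact_unit (@mpolyC _ C)).
Qed.

Lemma seriesA_gen N :
  seriesA N (genx C m.+2) (geny C m.+2) = frac (chainA N polyx polyy).
Proof.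
rewrite -gen_chainA; apply: seriesA_chain => [k|s k /andP[s0 le_sm]|k le_kN].
- exact: (fact_neq0 (frac \o @mpolyC _ C)).
- rewrite gen_nu; apply: frac_poch_neq0.
  rewrite /nu_fun sumrB /ev01 rmorphB [X in X - _]ev01_sumy; last exact: leqW.
  by rewrite [X in _ - X]ev01_sumx subr0 ltr0n.
(* At the test point this denominator becomes [(-N)_k], nonzero for [k <= N]. *)
- rewrite gen_vcompx gen_vcompy -(rmorph_nat frac N) -(rmorph1 frac).
  rewrite -rmorphB -rmorphD -rmorphB -rmorph_poch frac_neq0 // /ev01 rmorph_poch.
  rewrite !(rmorphB, rmorphD) rmorph1 rmorph_nat [X in _ - X + _]ev01_y ?leqnn //.
  rewrite [X in _ + X - _]ev01_x subrr add0r sub0r.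
  have := @poch_opp_nat C N k; rewrite le_kN => eq_k.
  apply: contraTneq isT => pochk0; move/eqP: eq_k; rewrite pochk0 mul0r eq_sym.
  by rewrite mulf_eq0 signr_eq0 (negbTE (fact_neq0 idfun N)).
Qed.

Lemma seriesB_gen N : (0 < m)%N ->
  seriesB N (genx C m.+2) (geny C m.+2) = frac (chainA N polyx polyy).
Proof.
move=> m0; rewrite -gen_chainA; apply: seriesB_chain => // [k|s k /andP[s0 le_sm]].
  exact: (fact_neq0 (frac \o @mpolyC _ C)).
(* At the test point all four parameters take the value [s]; for [s = m.+1] the component [x s.+1]
   is out of range and equals [0] by default. *)
rewrite !gen_psi !gen_vcompx !gen_vcompy -!rmorphB.
have le_sm' : (s <= m.+2)%N by rewrite leqW.
by split; apply: frac_poch_neq0; rewrite /ev01 rmorphB [X in X - _]ev01_psi //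
  ?[X in _ - X]ev01_x ?[X in _ - X]ev01_y ?s0 // ?subr0 -?[s.+1%:R]natr1 ?addrK ltr0n.
Qed.

End Generic.

(** * The inequalities and the conclusion *)

Lemma nonneg_condP (R : realType) p (x : 'rV[R]_p.-1) (y : 'rV[R]_p) :
  nonneg_cond x y <-> nonneg_cond_dnu x y.
Proof.
have eq_d q : (0 < q)%N -> nu_ x y q - nu_ x y q.-1 - vcomp y q + vcomp y q.+1 =
    vcomp y q.+1 - vcomp x q.
  by case: q => // q _; rewrite /= [nu_ x y q.+1]nu_funS /nu_fun -/(nu_ x y q); ring.
by split=> nn q q_p; have [? yx] := nn q q_p; split; move: yx => //;
  rewrite eq_d ?subr_ge0 //; case/andP: q_p.
Qed.

(** The quantity required to be non-negative is [nu_{q-1} + (y_{q+1} - x_q)], with [nu_0 = 0]. *)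
Lemma nonneg_cond_nuW (R : realType) p (x : 'rV[R]_p.-1) (y : 'rV[R]_p) :
  nonneg_cond x y -> nonneg_cond_nu x y.
Proof.
move=> nn q q_p; have [nu_ge0 yx] := nn q q_p; split=> //.
case: q q_p => // q /andP[_ le_q] in nu_ge0 yx *.
have -> : nu_ x y q.+1 - vcomp y q.+1 + vcomp y q.+2 =
    nu_ x y q + (vcomp y q.+2 - vcomp x q.+1).
  by rewrite [nu_ x y q.+1]nu_funS /nu_fun -/(nu_ x y q); ring.
rewrite addr_ge0 ?subr_ge0 //; case: q le_q {nu_ge0 yx} => [|q] le_q.
  by rewrite /nu_ big_geq.
by have [|] := nn q.+1; first exact: ltnW.
Qed.

Theorem theorem2p1 (R : realType) (p : nat) (hp : (3 <= p)%N) :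
  exists g : nat -> {mpoly R[i][p.-1 + p]},
    [/\ (* (i) *)
        forall n : nat,
          seriesA n (genx R[i] p) (geny R[i] p)
            = seriesB n (genx R[i] p) (geny R[i] p)
          /\ seriesA n (genx R[i] p) (geny R[i] p) = FracField.tofrac (g n),
        (* (ii) *)
        forall (n : nat) (x : 'rV[R[i]]_p.-1) (y : 'rV[R[i]]_p)
            (s : 'S_(p.-1)) (t : 'S_p),
          evalxy (g n) (col_perm s x) y = evalxy (g n) x y
          /\ evalxy (g n) x (col_perm t y) = evalxy (g n) x y,
        (* (iii) *)
        forall (m : nat) (w : 'I_p.-1) (x : 'rV[R[i]]_p.-1) (y : 'rV[R[i]]_p),
          evalxy (g m.+1) x y
            = evalxy (g m.+1) (drop_append x w (nu_total x y + m%:R)) y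
      & (* (iv) *)
        forall (x : 'rV[R]_p.-1) (y : 'rV[R]_p),
          [/\ nonneg_cond x y <-> nonneg_cond_dnu x y,
              nonneg_cond x y -> nonneg_cond_nu x y
            & forall n : nat, nonneg_cond x y ->
                0 <= evalxy (g n) (to_complex x) (to_complex y)] ].
Proof.
case: p hp => [|[|[|m]]] // _; exists (fun n => chainA n (polyx R[i] m.+1) (polyy R[i] m.+1)).
have Cu k : (k`!%:R : R[i]) \is a GRing.unit := fact_unit idfun k.
split=> [n|n x y s t|n w x y|x y].
- by rewrite seriesA_gen seriesB_gen.
- by rewrite !evalxy_chainA chainA_permx // chainA_permy.
- by rewrite !evalxy_chainA chainA_drop_append.
- split=> [||n nn]; [exact: nonneg_condP|exact: nonneg_cond_nuW|].
  (* The value at a real point is the image of the real chain, where the inequality is proved. *)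
  rewrite evalxy_chainA /to_complex rmorph_chainA => [|k]; last exact: (fact_unit idfun).
  by rewrite ler0c; apply: chain_kerA_ge0.
Qed.
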